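(* Let $G$ be a connected graph with at least two vertices and $H$ a graph with at least one edge. Then (i) $\chi_{\mu_i}(G\circ H)=\chi(G\circ H)$, and (ii) $\mu_i(G\circ H)=\alpha(G)\alpha(H)$.
   Context: All graphs are finite and simple. The lexicographic product $G\circ H$ has vertex set $V(G)\times V(H)$, with $(g,h)$ adjacent to $(g',h')$ iff $gg'\in E(G)$, or $g=g'$ and $hh'\in E(H)$. $\chi$ is the chromatic number and $\alpha$ the independence number. A geodesic is a shortest path. For $X\subseteq V(G)$, two vertices $x,y\in X$ are $X$-visible if some $x,y$-geodesic has no internal vertex in $X$; $X$ is an independent mutual-visibility (IMV) set if $X$ is independent and every two of its vertices are $X$-visible. $\mu_i(G)$ is the maximum size of an IMV set and $\chi_{\mu_i}(G)$ is the least $k$ such that $V(G)$ can be partitioned into $k$ IMV sets. *)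

(* Defs.v *)
From mathcomp Require Import all_boot.

Set Implicit Arguments.
Unset Strict Implicit.
Unset Printing Implicit Defensive.

Record sgraph := SGraph {
  vertex :> finType;
  adj : rel vertex;
  adj_sym : symmetric adj;
  adj_irr : irreflexive adj }.

Definition connected (G : sgraph) : Prop := forall x y : G, connect (@adj G) x y.

Section LexicographicProduct.
Variables G H : sgraph.

Definition lex_adj : rel (G * H) :=
  fun u v => adj u.1 v.1 || (u.1 == v.1) && adj u.2 v.2.

Lemma lex_adj_sym : symmetric lex_adj.
Proof.
by move=> u v; rewrite /lex_adj adj_sym eq_sym [adj u.2 _]adj_sym.
Qed.

Lemma lex_adj_irr : irreflexive lex_adj.
Proof. by move=> u; rewrite /lex_adj !adj_irr andbF. Qed.

Definition lexprod : sgraph := SGraph lex_adj_sym lex_adj_irr.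

End LexicographicProduct.

Section Invariants.
Variable G : sgraph.
Implicit Types (x y : G) (p q : seq G) (X : {set G}) (P : {set {set G}}).

Definition independent X : bool :=
  [forall x in X, forall y in X, ~~ adj x y].

Definition alpha : nat := \max_(X : {set G} | independent X) #|X|.

Definition colorable (k : nat) : bool :=
  [exists f : {ffun G -> 'I_k}, forall x, forall y, adj x y ==> (f x != f y)].

Lemma colorable_ex : exists k, colorable k.
Proof.
exists #|G|; apply/existsP; exists [ffun x => enum_rank x].
apply/forallP=> x; apply/forallP=> y; apply/implyP=> xy.
rewrite !ffunE (inj_eq enum_rank_inj).
by apply: contraL xy => /eqP ->; rewrite adj_irr.
Qed.

Definition chi : nat := ex_minn colorable_ex.

(* [x :: p] is a path (with pairwise distinct vertices) from x to y; its
   length is [size p]. *)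
Definition is_path x y p : bool :=
  [&& path (@adj G) x p, last x p == y & uniq (x :: p)].

(* Paths have fewer than #|G| edges, so quantifying over the finite type of
   sequences of length at most #|G| is the same as quantifying over all
   sequences: see [geodesicP] and [visibleP]. *)
Definition geodesic x y p : bool :=
  is_path x y p && [forall q : #|G|.-bseq G, is_path x y q ==> (size p <= size q)].

Definition internal x p : seq G := behead (belast x p).

Definition visible X x y : bool :=
  [exists p : #|G|.-bseq G,
    geodesic x y p && all [predC X] (internal x p)].

Lemma is_path_size x y p : is_path x y p -> size p <= #|G|.
Proof.
by case/and3P=> _ _ Up; apply: ltnW; have /card_uniqP := Up => /= <-; apply: max_card.
Qed.

Lemma geodesicP x y p :
  reflect (is_path x y p /\ forall q, is_path x y q -> size p <= size q)
          (geodesic x y p).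
Proof.
apply: (iffP andP) => -[xyp min_p]; split=> //.
  move=> q xyq; have /forallP/(_ (Bseq (is_path_size xyq))) := min_p.
  by move/implyP; apply.
by apply/forallP=> q; apply/implyP; apply: min_p.
Qed.

Lemma visibleP X x y :
  reflect (exists2 p, geodesic x y p & forall z, z \in internal x p -> z \notin X)
          (visible X x y).
Proof.
apply: (iffP existsP) => [[p /andP[gp /allP Xp]]|[p gp Xp]]; first by exists p.
have /geodesicP[xyp _] := gp.
by exists (Bseq (is_path_size xyp)); rewrite gp; apply/allP.
Qed.

Definition imv X : bool :=
  independent X && [forall x in X, forall y in X, (x != y) ==> visible X x y].

Definition mu_i : nat := \max_(X : {set G} | imv X) #|X|.

Definition imv_partitionable (k : nat) : bool :=
  [exists P : {set {set G}},
    [&& partition P [set: G], [forall X in P, imv X] & #|P| == k]].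

Lemma imv1 x : imv [set x].
Proof.
apply/andP; split; apply/forall_inP=> y /set1P->; apply/forall_inP=> z /set1P->.
  by rewrite adj_irr.
by rewrite eqxx.
Qed.

Lemma imv_partitionable_ex : exists k, imv_partitionable k.
Proof.
pose P := [set [set x] | x in [set: G]].
exists #|P|; apply/existsP; exists P; rewrite eqxx andbT; apply/andP; split.
  apply/and3P; split.
  - apply/eqP/setP=> x; rewrite inE; apply/bigcupP.
    by exists [set x]; rewrite ?set11 ?imset_f ?inE.
  - apply/trivIsetP=> _ _ /imsetP[x _ ->] /imsetP[y _ ->] xy.
    by rewrite disjoints1 inE; apply: contra xy => /eqP->.
  - by apply/imsetP=> -[x _ /setP/(_ x)]; rewrite !inE eqxx.
by apply/forall_inP=> _ /imsetP[x _ ->]; apply: imv1.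
Qed.

Definition chi_mu_i : nat := ex_minn imv_partitionable_ex.

End Invariants.

(* Main.v *)
(* Every independent set X of G o H is an IMV set.  Each H-layer contains an
   edge, hence a vertex outside X, so the interior of a G-geodesic lifts to G o H
   avoiding X; such a lift is a geodesic because walks of G o H project to walks
   of G that are no longer.  Two vertices of X in the same layer are joined
   through any vertex of an adjacent layer, which X cannot meet.  Hence both
   invariants only depend on the independent sets of G o H. *)
Require Import Defs.
From mathcomp Require Import all_boot.

Set Implicit Arguments.
Unset Strict Implicit.
Unset Printing Implicit Defensive.

(** * Paths, independent sets and colourings of a single graph *)

Section SimpleGraph.
Variable G : sgraph.
Implicit Types (x y : G) (p q : seq G) (X : {set G}).

Lemma independentP X :
  reflect {in X &, forall x y, ~~ adj x y} (independent X).
Proof.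
apply: (iffP forall_inP) => [iX x y xX yX | iX x xX].
  by move/forall_inP: (iX x xX); apply.
by apply/forall_inP=> y yX; apply: iX.
Qed.

Lemma imv_independent X : imv X -> independent X.
Proof. by case/andP. Qed.

(** [geodesic] competes only against duplicate-free paths, whereas walks projected from a product
    may repeat vertices; cutting out their cycles makes them comparable. *)
Lemma walk_to_path x p :
  path (@adj G) x p -> exists2 q, is_path x (last x p) q & size q <= size p.
Proof.
move=> xp; case/shortenP: xp => q xq Uq sub_qp; exists q.
  by rewrite /is_path xq eqxx.
by apply: uniq_leq_size sub_qp; case/andP: Uq.
Qed.

Lemma exists_geodesic x y :
  connect (@adj G) x y -> exists p, geodesic x y p.
Proof.
case/connectP=> p xp ->.
have [q xyq _] := walk_to_path xp.
(* Bounding the sequences makes this predicate on lengths boolean, as [ex_minnP] requires. *)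
have ex_len : exists n, [exists r : #|G|.-bseq G,
    is_path x (last x p) r && (size r == n)].
  exists (size q); apply/existsP; exists (Bseq (is_path_size xyq)).
  by rewrite xyq eqxx.
case: (ex_minnP ex_len) => n /existsP[r /andP[xyr /eqP <-]] min_r.
exists r; apply/geodesicP; split=> // s xys; apply: min_r.
by apply/existsP; exists (Bseq (is_path_size xys)); rewrite xys eqxx.
Qed.

Lemma connected_neighbor x :
  connected G -> 2 <= #|G| -> exists y, adj x y.
Proof.
move=> cG; rewrite (cardD1 x) ltnS => /card_gt0P[y /andP[y_neq_x _]].
have /connectP[[|z p] /= xp y_last] := cG x y.
  by rewrite y_last eqxx in y_neq_x.
by exists z; case/andP: xp.
Qed.

Lemma leq_alpha X : independent X -> #|X| <= alpha G.
Proof. exact: (@leq_bigmax_cond _ _ (fun X : {set G} => #|X|)). Qed.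

Lemma alpha_witness : exists2 X : {set G}, independent X & #|X| = alpha G.
Proof.
have i0 : independent (set0 : {set G}).
  by apply/independentP=> x y; rewrite inE.
have [|X iX eqX] :=
  @eq_bigmax_cond _ [pred X : {set G} | independent X] (fun X => #|X|).
  by apply/card_gt0P; exists set0.
by exists X.
Qed.

Lemma colorable_partition k (P : {set {set G}}) :
  partition P [set: G] -> {in P, forall X, independent X} -> #|P| = k ->
  colorable G k.
Proof.
move=> partP iP <-; have /and3P[/eqP covP tiP _] := partP.
have inP x : pblock P x \in P by rewrite pblock_mem // covP inE.
(* A vertex is coloured by the rank of its block in [P]. *)
apply/existsP; exists [ffun x => enum_rank_in (inP x) (pblock P x)].
apply/forallP=> x; apply/forallP=> y; apply/implyP=> xy; rewrite !ffunE.
apply: contraL xy => /eqP/(congr1 enum_val).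
rewrite !enum_rankK_in // => eq_xy.
apply: (independentP _ (iP _ (inP x))); first by rewrite mem_pblock covP inE.
by rewrite eq_xy mem_pblock covP inE.
Qed.

(** The blocks are the nonempty colour classes; a colouring may miss some colours, hence an
    inequality on [#|P|]. *)
Lemma partition_colorable k :
  colorable G k ->
  exists P : {set {set G}}, [/\ partition P [set: G],
    {in P, forall X, independent X} & #|P| <= k].
Proof.
case/existsP=> f /forallP fP; exists (preim_partition f [set: G]); split.
- exact: preim_partitionP.
- move=> _ /imsetP[x _ ->]; apply/independentP=> y z.
  rewrite !inE /= => /eqP xy /eqP xz; apply/negP=> yz.
  by have /forallP/(_ z) := fP y; rewrite yz /= -xy -xz eqxx.
have sub : preim_partition f [set: G] \subset
    [set [set x | f x == i] | i : 'I_k].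
  apply/subsetP=> _ /imsetP[x _ ->]; apply/imsetP; exists (f x) => //.
  by apply/setP=> y; rewrite !inE /= eq_sym.
apply: leq_trans (subset_leq_card sub) _.
by apply: leq_trans (leq_imset_card _ _) _; rewrite card_ord.
Qed.

Lemma chi_mu_iE : (forall X, independent X -> imv X) -> chi_mu_i G = chi G.
Proof.
move=> all_imv; rewrite /chi_mu_i /chi.
case: ex_minnP => m /existsP[P /and3P[partP /forall_inP imvP /eqP cardP]] min_m.
case: ex_minnP => k col_k min_k; apply/eqP; rewrite eqn_leq; apply/andP; split.
  have [Q [partQ iQ leQ]] := partition_colorable col_k.
  apply: leq_trans (min_m _ _) leQ; apply/existsP; exists Q.
  rewrite partQ eqxx andbT /=.
  by apply/forall_inP=> X /iQ; apply: all_imv.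
apply/min_k/(colorable_partition partP) => // X /imvP.
exact: imv_independent.
Qed.

Lemma mu_iE : (forall X, independent X -> imv X) -> mu_i G = alpha G.
Proof.
move=> all_imv; apply: eq_bigl => X.
by apply/idP/idP; [apply: imv_independent | apply: all_imv].
Qed.

End SimpleGraph.

(** * Independent sets and geodesics of the lexicographic product *)

Section Lexprod.
Variables G H : sgraph.
Notation GH := (lexprod G H).
Implicit Types (x y : GH) (p : seq GH) (X : {set GH}).

Definition layer X (g : G) : {set H} := [set h | ((g, h) : GH) \in X].

Lemma independent_layer X g : independent X -> independent (layer X g).
Proof.
move=> /independentP iX; apply/independentP=> h h'; rewrite !inE => gh gh'.
by have := iX _ _ gh gh'; rewrite /= /lex_adj /= eqxx adj_irr.
Qed.

Lemma independent_fst X : independent X -> independent [set x.1 | x : GH in X].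
Proof.
move=> /independentP iX; apply/independentP=> _ _ /imsetP[x xX ->] /imsetP[y yX ->].
by have := iX _ _ xX yX; rewrite /= /lex_adj negb_or => /andP[].
Qed.

Lemma independent_setX (A : {set G}) (B : {set H}) :
  independent A -> independent B -> @independent GH (setX A B).
Proof.
move=> /independentP iA /independentP iB; apply/independentP.
move=> [g h] [g' h'] /setXP[gA hB] /setXP[g'A h'B].
by rewrite /= /lex_adj negb_or negb_and iA // iB // orbT.
Qed.

(** An independent set projects to an independent set of [G], over which its fibres are independent
    in [H]; conversely, the product of two maximum independent sets is independent. *)
Lemma alpha_lexprod : alpha GH = alpha G * alpha H.
Proof.
apply/eqP; rewrite eqn_leq; apply/andP; split.
  apply/bigmax_leqP=> X iX.
  rewrite -sum1_card (partition_big_imset (fun x : GH => x.1)) /=.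
  have iA := independent_fst iX.
  apply: leq_trans (leq_mul (leq_alpha iA) (leqnn _)).
  rewrite -sum_nat_const; apply: leq_sum => g _.
  apply: leq_trans (leq_alpha (independent_layer g iX)).
  rewrite sum1dep_card.
  rewrite -(card_imset (layer X g) (f := fun h => (g, h) : GH)); last by move=> h h' [].
  apply/subset_leq_card/subsetP => -[g' h]; rewrite inE /= => /andP[ghX /eqP eg].
  by apply/imsetP; exists h; rewrite ?inE -eg.
have [A iA <-] := alpha_witness G; have [B iB <-] := alpha_witness H.
by rewrite -cardsX; apply: leq_alpha (independent_setX iA iB).
Qed.

(** Edges inside a layer collapse to a point, so the projection can only get shorter. *)
Lemma project_walk x p :
  path (@adj GH) x p ->
  exists q, [/\ path (@adj G) x.1 q, last x.1 q = (last x p).1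
              & size q <= size p].
Proof.
elim: p x => [|y p IHp] x /=; first by exists [::].
case/andP=> xy /IHp[q [yq lastq leq]].
case/orP: xy => [xy | /andP[/eqP exy _]]; first by exists (y.1 :: q); rewrite /= xy.
by exists q; rewrite exy; split=> //; apply: leqW.
Qed.

(** Adjacent layers are completely joined, so second coordinates can be chosen freely along the
    walk. *)
Lemma lift_walk (s : G -> H) (x : GH) g h (p : seq G) :
  path (@adj G) x.1 (rcons p g) ->
  path (@adj GH) x (rcons [seq (z, s z) | z <- p] (g, h)).
Proof.
elim: p x => [|z p IHp] x /=; rewrite /lex_adj /=; first by case/andP=> ->.
by case/andP=> -> zp; apply: (IHp (z, s z)).
Qed.

Lemma geodesic_lift (s : G -> H) x y (p : seq G) :
  geodesic x.1 y.1 (rcons p y.1) ->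
  geodesic x y (rcons [seq (z, s z) | z <- p] y).
Proof.
case/geodesicP=> /and3P[xp _ Up] min_p; apply/geodesicP; split.
  rewrite /is_path last_rcons eqxx /=; apply/andP; split.
    by case: y xp {Up min_p} => g h; apply: lift_walk.
  (* The first coordinates are the vertices of the given geodesic, already distinct. *)
  apply: (@map_uniq _ _ (fun z : GH => z.1) (x :: _)).
  by rewrite /= map_rcons -map_comp map_id.
(* A competitor [q] is projected to a walk [r], then shortened to a path [t], which the geodesic of
   [G] does not exceed. *)
move=> q /and3P[xq /eqP lastq _].
have [r [xr lastr le_rq]] := project_walk xq.
have [t xyt le_tr] := walk_to_path xr.
rewrite lastr lastq in xyt.
have := min_p t xyt; rewrite !size_rcons size_map => le_pt.
exact: leq_trans le_pt (leq_trans le_tr le_rq).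
Qed.

Lemma geodesic_same_layer x y (z : GH) :
  x.1 = y.1 -> x != y -> ~~ adj x y -> adj x.1 z.1 -> geodesic x y [:: z; y].
Proof.
move=> exy neq_xy nadj xz; apply/geodesicP; split.
  have zx : adj z.1 y.1 by rewrite -exy adj_sym.
  have neq1 (u v : GH) : adj u.1 v.1 -> u != v.
    by apply: contraL => /eqP->; rewrite adj_irr.
  by rewrite /is_path /= /lex_adj xz zx eqxx !inE negb_or neq_xy !neq1.
(* Only lengths 0 and 1 could beat 2: they would force [x = y] or an edge between [x] and [y]. *)
case=> [|u [|v q]] //; rewrite /is_path /=.
  by rewrite (negPf neq_xy).
by rewrite andbT => /and3P[xu /eqP eu _]; rewrite eu /= in xu; rewrite /= xu in nadj.
Qed.

Lemma layer_avoid X g :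
  (exists h h' : H, adj h h') -> independent X -> exists h, ((g, h) : GH) \notin X.
Proof.
move=> [h [h' hh']] /(independent_layer g)/independentP iX.
case: (boolP (((g, h) : GH) \in X)) => [ghX | ?]; last by exists h.
exists h'; apply: contraL hh' => gh'X.
by apply: iX; rewrite inE.
Qed.

Lemma imv_lexprod X :
  connected G -> 2 <= #|G| -> (exists h h' : H, adj h h') ->
  independent X -> imv X.
Proof.
move=> cG ge2 edge iX; apply/andP; split=> //; have /independentP nadj := iX.
apply/forall_inP=> x xX; apply/forall_inP=> y yX; apply/implyP=> neq_xy.
apply/visibleP; have [exy | nexy] := eqVneq x.1 y.1.
  have [g xg] := connected_neighbor x.1 cG ge2.
  exists [:: (g, x.2) : GH; y]; first exact: geodesic_same_layer (nadj _ _ xX yX) _.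
  move=> z; rewrite inE => /eqP->; apply/negP=> /(nadj _ _ xX).
  by rewrite /= /lex_adj xg.
have avoid g : exists h, ((g, h) : GH) \notin X by apply: layer_avoid.
(* [s] selects in each layer a vertex outside [X]. *)
pose s g := xchoose (avoid g).
have [p gp] := exists_geodesic (cG x.1 y.1).
have lastp : last x.1 p = y.1 by case/andP: gp => /and3P[_ /eqP].
(* The end of the geodesic is split off: it must lift to [y], which lies in [X], and not through
   [s]. *)
case: (lastP p) lastp gp => [/= exy | q g]; first by rewrite exy eqxx in nexy.
rewrite last_rcons => -> gq.
exists (rcons [seq (z, s z) | z <- q] y); first exact: geodesic_lift.
move=> z; rewrite /internal belast_rcons /= => /mapP[g' _ ->].
exact: xchooseP (avoid g').
Qed.

End Lexprod.

Theorem theorem4p14 (G H : sgraph)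
    (G_connected : connected G) (G_ge2 : 2 <= #|G|)
    (H_edge : exists h h' : H, adj h h') :
  chi_mu_i (lexprod G H) = chi (lexprod G H) /\
  mu_i (lexprod G H) = alpha G * alpha H.
Proof.
have all_imv X := @imv_lexprod G H X G_connected G_ge2 H_edge.
by split; [apply: chi_mu_iE | rewrite mu_iE // alpha_lexprod].
Qed.
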